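(* For every positive integer $k$ there exists a constant $c=c(k)>0$ with the following property. If $G$ is an ordered graph on $n$ vertices such that neither $G$ nor its complement $\overline{G}$ contains an induced monotone path of size $k$, then $G$ has either a clique or an independent set of size at least $n^{c}$.
   Context: An ordered graph is a graph together with a total ordering $\prec$ of its vertex set. An ordered graph $H$ is an induced ordered subgraph of an ordered graph $G$ if there is an order-preserving injection $V(H)\to V(G)$ mapping edges to edges and non-edges to non-edges. The monotone path of size $k$ is the ordered graph on vertices $1\prec 2\prec\dots\prec k$ with edges $\{i,i+1\}$ for $i=1,\dots,k-1$. The complement $\overline{G}$ of an ordered graph $G$ has the same vertex set and ordering, with edges exactly the non-edges of $G$. *)

(* Defs.v *)
From HB Require Import structures.
From mathcomp Require Import all_boot all_order all_algebra.
From mathcomp Require Import reals exp.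

Set Implicit Arguments.
Unset Strict Implicit.
Unset Printing Implicit Defensive.

Import Order.TTheory.
Local Open Scope order_scope.

Record ordered_graph := OrderedGraph {
  vertex_disp : Order.disp_t;
  vertex :> finOrderType vertex_disp;
  edge : rel vertex;
  edge_sym : symmetric edge;
  edge_irr : irreflexive edge }.

Arguments edge : clear implicits.

Section Complement.
Variable G : ordered_graph.

Definition compl_edge : rel G := fun x y => (x != y) && ~~ edge G x y.

Lemma compl_edge_sym : symmetric compl_edge.
Proof. by move=> x y; rewrite /compl_edge eq_sym edge_sym. Qed.

Lemma compl_edge_irr : irreflexive compl_edge.
Proof. by move=> x; rewrite /compl_edge eqxx. Qed.

Definition compl_graph : ordered_graph :=
  OrderedGraph compl_edge_sym compl_edge_irr.

End Complement.

Section MonotonePath.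
Variable k : nat.

(* The vertices are 0, ..., k-1 instead of 1, ..., k. *)
Definition path_edge : rel 'I_k :=
  fun i j => (j == i.+1 :> nat) || (i == j.+1 :> nat).

Lemma path_edge_sym : symmetric path_edge.
Proof. by move=> i j; rewrite /path_edge orbC. Qed.

Lemma path_edge_irr : irreflexive path_edge.
Proof. by move=> i; rewrite /path_edge orbb ltn_eqF. Qed.

Definition monotone_path : ordered_graph :=
  OrderedGraph path_edge_sym path_edge_irr.

End MonotonePath.

Definition induced_ordered_subgraph (H G : ordered_graph) : Prop :=
  exists f : H -> G,
    [/\ injective f,
        {homo f : x y / x <= y} &
        forall x y, edge G (f x) (f y) = edge H x y].

Definition clique (G : ordered_graph) (A : {set G}) : Prop :=
  {in A &, forall x y, x != y -> edge G x y}.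

Definition independent (G : ordered_graph) (A : {set G}) : Prop :=
  {in A &, forall x y, ~~ edge G x y}.

(* Main.v *)
Require Import Defs.
From HB Require Import structures.
From mathcomp Require Import all_boot all_order all_algebra.
From mathcomp Require Import reals exp.
From mathcomp Require Import zify.

Set Implicit Arguments.
Unset Strict Implicit.
Unset Printing Implicit Defensive.

Import Order.TTheory GRing.Theory Num.Theory.
Local Open Scope nat_scope.

(* A Rödl-type argument first passes to a linear-size vertex set W on which G or
   its complement, say G, has small maximum degree.  Inside W, either some vertex
   reaches linearly many vertices along increasing paths, and then deleting its
   neighbourhood and continuing from the neighbour with the largest reach builds
   an induced monotone path; or all reach sets are small but cover W.  In the
   second case a comb, that is t reach sets whose private parts all have size at
   least |W| / t^O(1), is found by a greedy dyadic argument, and the private parts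
   of reach sets are pairwise anticomplete.  So there are always t >= 2 sets of size
   n / t^C that are pairwise complete or pairwise anticomplete, and induction gives
   n <= (|clique| * |independent set|)^C. *)

(** * Combs in set systems *)

Lemma leq_card_bigcup (I T : finType) (P : pred I) (F : I -> {set T}) :
  #|\bigcup_(i | P i) F i| <= \sum_(i | P i) #|F i|.
Proof.
elim/big_rec2: _ => [|i n X _ IH]; first by rewrite cards0.
by rewrite (leq_trans (leq_card_setU _ _)) ?leq_add2l.
Qed.

Lemma sum_card_disjoint (I T : finType) (J : {set I}) (F : I -> {set T})
    (Y : {set T}) :
  {in J &, forall i j, i != j -> [disjoint F i & F j]} ->
  (forall i, i \in J -> F i \subset Y) ->
  \sum_(i in J) #|F i| <= #|Y|.
Proof.
move=> disF subF.
pose c := \sum_(y in Y) \sum_(i in J) (y \in F i).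
have -> : \sum_(i in J) #|F i| = c.
  rewrite /c exchange_big /=; apply: eq_bigr => i iJ.
  rewrite -sum1_card -big_mkcondr /=; apply: eq_bigl => y.
  by case: (boolP (y \in F i)) => [/(subsetP (subF i iJ))->|]; rewrite ?andbF.
rewrite -sum1_card leq_sum // => y yY.
case: (pickP [pred i in J | y \in F i]) => [i /= /andP[iJ yi]|no].
  rewrite (bigD1 i) //= yi big1 // => j /andP[jJ ji].
  by have /disjointFl -> := disF _ _ jJ iJ ji.
by rewrite big1 // => i iJ; have /= := no i; rewrite iJ /= => ->.
Qed.

(* Some vertex has in-degree at most [q]; pick it and delete its closed
   neighbourhood. *)
Lemma digraph_independent (I : finType) (r : rel I) (q t : nat) (J : {set I}) :
  (forall j, j \in J -> #|[set i in J | r j i]| <= q) ->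
  t * q.*2.+1 <= #|J| ->
  exists J' : {set I}, [/\ J' \subset J, #|J'| = t &
    {in J' &, forall i j, i != j -> ~~ r i j}].
Proof.
elim: t J => [|t IH] J outJ.
  by exists set0; split; rewrite ?sub0set ?cards0 // => i j; rewrite inE.
move=> cJ.
have [i iJ ini] : exists2 i, i \in J & #|[set j in J | r j i]| <= q.
  apply/exists_inP; apply: contraT; rewrite negb_exists_in => /forall_inP big.
  have : \sum_(i in J) q.+1 <= \sum_(i in J) #|[set j in J | r j i]|.
    by apply: leq_sum => i /big; rewrite -ltnNge.
  have -> : \sum_(i in J) #|[set j in J | r j i]| = \sum_(j in J) #|[set i in J | r j i]|.
    under eq_bigr do rewrite cardsE -sum1_card big_mkcondr /=.
    rewrite exchange_big /=; apply: eq_bigr => j _.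
    by rewrite cardsE -sum1_card [RHS]big_mkcondr.
  move=> le1; have : \sum_(i in J) q.+1 <= \sum_(i in J) q.
    by rewrite (leq_trans le1) // leq_sum.
  rewrite !sum_nat_const; nia.
pose D := [set i] :|: ([set j in J | r i j] :|: [set j in J | r j i]).
have cD : #|D| <= q.*2.+1.
  rewrite (leq_trans (leq_card_setU _ _)) // cards1 add1n ltnS.
  by rewrite (leq_trans (leq_card_setU _ _)) // -addnn leq_add ?outJ.
have [||J' [sJ' cJ' indJ']] := IH (J :\: D).
- move=> j /setDP[jJ _]; apply: leq_trans (outJ j jJ); apply: subset_leq_card.
  by apply/subsetP => x; rewrite !inE => /andP[/andP[_ ->] ->].
- by have := cardsID D J; have := subset_leq_card (subsetIr J D); lia.
exists (i |: J'); split.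
- by rewrite subUset sub1set iJ (subset_trans sJ') ?subsetDl.
- rewrite cardsU1 cJ'; case: (boolP (i \in J')) => // /(subsetP sJ').
  by rewrite !inE eqxx.
have notD j : j \in J' -> ~~ r i j && ~~ r j i.
  move=> /(subsetP sJ'); rewrite !inE negb_or => /andP[/andP[_]] + jJ.
  by rewrite jJ negb_or.
move=> x y; rewrite !inE => /predU1P[->|xJ] /predU1P[->|yJ]; rewrite ?eqxx //.
- by case/andP: (notD _ yJ).
- by case/andP: (notD _ xJ).
exact: indJ'.
Qed.

Section Comb.
Variables (I T : finType) (R : I -> {set T}) (A : {set I}).

Definition private (J : {set I}) (i : I) : {set T} :=
  R i :\: \bigcup_(j in J | j != i) R j.

(** Pick a set that meets the uncovered part of [C] in at least [s] points, delete it, and repeat.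
    [X i] is what pick [i] newly covers, so the [X i] are disjoint, and one pick removes at most
    [16 * s] points. If the process stops early, every set is small on what is left. *)
Lemma greedy_window (s w : nat) (C : {set T}) : 0 < s ->
  (forall i, i \in A -> #|R i :&: C| <= 16 * s) ->
  (exists (J : {set I}) (X : I -> {set T}),
    [/\ J \subset A, #|J| = w,
        {in J &, forall i j, i != j -> [disjoint X i & X j]} &
        forall i, i \in J -> X i \subset R i :&: C /\ s <= #|X i|]) \/
  (exists C' : {set T}, [/\ C' \subset C, #|C| <= #|C'| + w * (16 * s) &
    forall i, i \in A -> #|R i :&: C'| < s]).
Proof.
move=> s0; elim: w C => [|w IH] C leC.
  by left; exists set0, (fun=> set0); split;
    rewrite ?sub0set ?cards0 // => i; rewrite ?inE //; move=> j; rewrite inE.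
case: (boolP [exists i in A, s <= #|R i :&: C|]) => [/exists_inP[i iA big]|]; last first.
  rewrite negb_exists_in => /forall_inP small; right; exists C; split=> //.
    exact: leq_addr.
  by move=> i /small; rewrite -ltnNge.
have [|[J [X [JA cJ disX Xs]]]|[C' [sC' cC' small]]] := IH (C :\: R i).
- move=> j jA; apply: leq_trans (leC j jA); apply/subset_leq_card/setIS/subsetDl.
- left; have iJ : i \notin J.
    apply/negP => /Xs[Xi]; suff -> : X i = set0 by rewrite cards0; lia.
    by apply/eqP; rewrite -subset0 (subset_trans Xi) // setIDA setIC -setIDA setDv setI0.
  exists (i |: J), (fun j => if j == i then R i :&: C else X j); split.
  + by rewrite subUset sub1set iA.
  + by rewrite cardsU1 iJ cJ.
  + have disi j : j \in J -> [disjoint X j & R i :&: C].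
      move=> /Xs[Xj _]; rewrite -setI_eq0 -subset0.
      apply/subsetP => x; rewrite !inE => /and3P[/(subsetP Xj)].
      by rewrite !inE => /and3P[_ /negbTE->].
    move=> x y; rewrite !inE => /predU1P[->|xJ] /predU1P[->|yJ]; rewrite ?eqxx //.
    * by move=> iy; rewrite ?eqxx eq_sym (negbTE iy) disjoint_sym disi.
    * by move=> xi; rewrite ?eqxx (negbTE xi) disi.
    by rewrite !(negbTE (memPn iJ _ _)) //; apply: disX.
  + move=> j; rewrite !inE; case: eqP => [-> _|_ /= /Xs[Xj sj]]; split=> //.
    by rewrite (subset_trans Xj) ?setIS ?subsetDl.
right; exists C'; split=> //; first by rewrite (subset_trans sC') ?subsetDl.
have := cardsID (R i) C; rewrite setIC; have := leC i iA; rewrite mulSn; lia.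
Qed.

(** Say that [j] hurts [i] when [R j] takes more than [s / (2 * t)] points of [X i]. As the [X i]
    are disjoint, one [j] hurts at most [32 * t] indices, whence the [64 * t]. Among [t] indices
    that do not hurt one another, each [X i] keeps at least [s / 2] private points. *)
Lemma window_comb (s t : nat) (C : {set T}) (J : {set I}) (X : I -> {set T}) :
  0 < t ->
  (forall i, i \in J -> #|R i :&: C| <= 16 * s) ->
  t * (64 * t).+1 <= #|J| ->
  {in J &, forall i j, i != j -> [disjoint X i & X j]} ->
  (forall i, i \in J -> X i \subset R i :&: C /\ s <= #|X i|) ->
  exists J' : {set I}, [/\ J' \subset J, #|J'| = t &
    forall i, i \in J' -> s <= 2 * #|private J' i|].
Proof.
move=> t0 leC cJ disX Xs.
have [s0|s0] := posnP s.
  (* For [s = 0] the bound is void, and the empty relation merely yields a subset of size [t]. *)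
  have [J' [J'J cJ' _]] := @digraph_independent _ (fun _ _ => false) (32 * t) t J
    (fun j _ => ltac:(by rewrite (@eq_card0 _ _) // => x; rewrite !inE andbF)) ltac:(lia).
  by exists J'; split=> // i; rewrite s0.
have [||J' [J'J cJ' ind]] :=
  @digraph_independent _ (fun j i => s < 2 * t * #|R j :&: X i|) (32 * t) t J.
- move=> j jJ; set N := [set i in J | _].
  have : \sum_(i in N) s <= \sum_(i in N) 2 * t * #|R j :&: X i|.
    by apply: leq_sum => i; rewrite inE => /andP[_ /ltnW].
  rewrite -big_distrr /= sum_nat_const => le1.
  have : \sum_(i in N) #|R j :&: X i| <= #|R j :&: C|.
    apply: sum_card_disjoint => [i i'|i].
      rewrite !inE => /andP[iJ _] /andP[i'J _] ne.
      have := disX _ _ iJ i'J ne; apply: disjointW; exact: subsetIr.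
    rewrite inE => /andP[iJ _]; apply: setIS.
    by case: (Xs i iJ) => Xi _; rewrite (subset_trans Xi) ?subsetIr.
  have := leC j jJ; nia.
- by apply: leq_trans cJ; rewrite leq_mul2l; lia.
exists J'; split=> // i iJ'.
have iJ := subsetP J'J _ iJ'; have [Xi sX] := Xs i iJ.
pose Y := \bigcup_(j in J' | j != i) (R j :&: X i).
have subY : X i :\: Y \subset private J' i.
  apply/subsetP => x; rewrite !inE => /andP[xY xX].
  have := subsetP Xi _ xX; rewrite inE => /andP[-> _]; rewrite andbT.
  apply: contra xY => /bigcupP[j jJ xj]; apply/bigcupP; exists j => //.
  by rewrite inE xj.
have cY : 2 * #|Y| <= s.
  rewrite -(leq_pmul2l t0).
  apply: (@leq_trans (\sum_(j in J' | j != i) 2 * t * #|R j :&: X i|)).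
    by rewrite -big_distrr /= mulnCA mulnA leq_mul2l leq_card_bigcup orbT.
  apply: (@leq_trans (\sum_(j in J' | j != i) s)).
    apply: leq_sum => j /andP[jJ' ji].
    by have := ind _ _ jJ' iJ' ji; rewrite -leqNgt.
  rewrite sum_nat_const leq_mul2r -cJ'; apply/orP; right.
  by apply/subset_leq_card/subsetP => x /andP[].
have := subset_leq_card subY; have := cardsID Y (X i).
have := subset_leq_card (subsetIr (X i) Y); lia.
Qed.

(* At level [l] no set meets the uncovered part [C] in more than [16 ^ l]
   points.  A window of [65 * 4 ^ (D - l)] greedy choices at this level yields a
   comb with [2 ^ (D - l)] teeth, and failing that a geometrically small part
   of [C] gets covered. *)
Lemma comb_levels (D l : nat) (C : {set T}) : l <= D ->
  C \subset \bigcup_(i in A) R i ->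
  (forall i, i \in A -> #|R i :&: C| < 16 ^ l) ->
  347 * 4 ^ (D + l) <= #|C| ->
  exists (J : {set I}) (u : nat), [/\ J \subset A, 0 < u <= D, #|J| = 2 ^ u &
    forall i, i \in J -> 16 ^ (D - u) <= 2 * #|private J i|].
Proof.
elim: l C => [|l IH] C lD covC small bigC.
  have : 0 < #|C| by apply: leq_trans bigC; rewrite muln_gt0 expn_gt0.
  case/card_gt0P => x xC; have /bigcupP[i iA xi] := subsetP covC _ xC.
  have := small i iA; rewrite expn0 ltnS leqn0 cards_eq0 => /eqP/setP/(_ x).
  by rewrite !inE xi xC.
pose t := 2 ^ (D - l).
have [|i iA|[J [X [JA cJ disX Xs]]]|[C' [sC' cC' small']]] :=
    @greedy_window (16 ^ l) (t * (64 * t).+1) C.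
- by rewrite expn_gt0.
- by rewrite -expnS ltnW ?small.
- have [|||J' [J'J cJ' priv]] := @window_comb (16 ^ l) t C J X _ _ _ disX Xs.
  + by rewrite expn_gt0.
  + by move=> i /(subsetP JA) /small; rewrite expnS => /ltnW.
  + by rewrite cJ.
  exists J', (D - l); split=> //; first exact: subset_trans JA.
  + by rewrite subn_gt0 lD leq_subr.
  + by rewrite subKn // ltnW.
apply: (IH C') => //; [exact: ltnW|exact: subset_trans covC|].
(* The window covers at most [65 * 16 = 1040] times [4 ^ (D + l)] points, while the threshold drops
   from [4 * 347] to [347] times that power; [347] is the least integer whose triple reaches
   [1040]. *)
have tE : t * t * 16 ^ l = 4 ^ (D + l).
  rewrite /t -expnD addnn -mul2n (expnM 2 2) -[2 ^ 2]/4 -[16]/(4 ^ 2) -(expnM 4 2) -(expnD 4).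
  by congr (_ ^ _); lia.
have := bigC; rewrite addnS expnS -tE; have : 1 <= t by rewrite expn_gt0.
have : 1 <= 16 ^ l by rewrite expn_gt0.
move: cC'; move: (16 ^ l) => s; move=> h1 h2 h3 h4.
have : t * s <= t * t * s by rewrite leq_mul2r leq_pmulr ?orbT.
nia.
Qed.

(** [comb_levels] is started at the top level [D], where [347 * 16 ^ D <= #|B| < 347 * 16 ^ (D +
    1)]. For a comb with [2 ^ u] teeth, [16 ^ D = #|J| ^ 4 * 16 ^ (D - u)], and [2 ^ 14] exceeds the
    total constant [347 * 16 * 2]. *)
Lemma comb_lemma (B : {set T}) :
  B \subset \bigcup_(i in A) R i -> 0 < #|B| ->
  (exists2 i, i \in A & #|B| <= 2 ^ 14 * #|R i|) \/
  (exists J : {set I}, [/\ J \subset A, 1 < #|J| &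
    forall i, i \in J -> #|B| <= 2 ^ 14 * #|J| ^ 4 * #|private J i|]).
Proof.
move=> covB B0.
case: (boolP [exists i in A, #|B| <= 2 ^ 14 * #|R i|]) => [/exists_inP|]; first by left.
rewrite negb_exists_in => /forall_inP small; right.
case: (ltnP #|B| 347) => [B347|B347].
  (* Below [347], any nonempty [R i] already violates [small]. *)
  have /card_gt0P[x xB] := B0; have /bigcupP[i iA xi] := subsetP covB _ xB.
  have := small i iA; have : 0 < #|R i| by apply/card_gt0P; exists x.
  lia.
pose D := trunc_log 16 (#|B| %/ 347).
have B1 : 0 < #|B| %/ 347 by rewrite divn_gt0.
have lo := trunc_logP (isT : 1 < 16) B1.
have hi := trunc_log_ltn (#|B| %/ 347) (isT : 1 < 16).
rewrite -/D in lo hi.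
have lo' : 347 * 16 ^ D <= #|B|.
  by rewrite mulnC (leq_trans _ (leq_divM #|B| 347)) // leq_mul2r lo orbT.
have hi' : #|B| < 347 * 16 * 16 ^ D.
  by rewrite -mulnA -expnS mulnC -ltn_divLR.
have [||J [u [JA /andP[u0 uD] cJ priv]]] := @comb_levels D D B (leqnn D) covB.
- move=> i iA; have := small i iA; rewrite -ltnNge.
  by have := subset_leq_card (subsetIl (R i) B); lia.
- by rewrite addnn -mul2n expnM.
exists J; split=> //; first by rewrite cJ -{1}(expn0 2) ltn_exp2l.
move=> i iJ; have := priv i iJ.
have -> : #|J| ^ 4 = 16 ^ u by rewrite cJ -expnM mulnC expnM.
have E : 16 ^ D = 16 ^ u * 16 ^ (D - u) by rewrite -expnD subnKC.
move: hi'; rewrite E; move: (16 ^ u) (16 ^ (D - u)) (#|private J i|) => a b c.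
move=> h1 h2; have : a * b <= a * (2 * c) by rewrite leq_mul2l h2 orbT.
lia.
Qed.
End Comb.

(** * Reachability along increasing paths *)

Definition joined (T : finType) (e : rel T) (X Y : {set T}) : bool :=
  [forall x in X, forall y in Y, e x y].

Definition compl (T : eqType) (e : rel T) : rel T :=
  fun x y => (x != y) && ~~ e x y.

Lemma joinedP (T : finType) (e : rel T) (X Y : {set T}) :
  reflect {in X & Y, forall x y, e x y} (joined e X Y).
Proof.
apply: (iffP forall_inP) => [h x y xX yY|h x xX].
  by have /forall_inP := h x xX; apply.
by apply/forall_inP => y yY; apply: h.
Qed.

Lemma uniq_pairwise_in (T : eqType) (r : rel T) (s : seq T) : uniq s ->
  {in s &, forall x y, x != y -> r x y} -> pairwise r s.
Proof.
rewrite uniq_pairwise => us h.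
exact: (sub_in_pairwise h (allss s) us).
Qed.

Lemma connect_ind (T : finType) (r : rel T) (P : pred T) (x y : T) :
  P x -> (forall u v, P u -> r u v -> P v) -> connect r x y -> P y.
Proof.
move=> Px step /connectP[p + ->]; elim: p x Px => //= z p IH x Px /andP[xz].
by apply: IH; apply: step xz.
Qed.

Section SparseGraph.
Variables (d : Order.disp_t) (V : finOrderType d) (e : rel V).

(** An induced monotone path, listed in increasing order. Adjacency is tested only from earlier to
    later vertices, which settles both directions when [e] is symmetric. *)
Fixpoint ipath (s : seq V) : bool :=
  if s is x :: s' then
    [&& all (fun y => x < y)%O s',
        (if s' is y :: s'' then e x y && all (fun z => ~~ e x z) s'' else true) &
        ipath s']
  else true.

Definition up (B : {set V}) : rel V :=
  fun x y => [&& e x y, (x < y)%O & y \in B].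

(** Only the later vertices of the path must lie in [B]; the start [x] may lie outside, and counts
    as reached exactly when it is in [B]. *)
Definition reach (B : {set V}) (x : V) : {set V} :=
  [set y in B | connect (up B) x y].

Lemma reach_step (B : {set V}) (w x y : V) :
  x \in reach B w -> up B x y -> y \in reach B w.
Proof.
rewrite !inE => /andP[_ wx] xy; have /and3P[_ _ ->] := xy.
exact: connect_trans wx (connect1 xy).
Qed.

Lemma reach_root (B : {set V}) (w y : V) : up B w y -> y \in reach B w.
Proof. by move=> wy; rewrite inE connect1 // andbT; case/and3P: wy. Qed.

Lemma reach_le (B : {set V}) (w x : V) : x \in reach B w -> (w <= x)%O.
Proof.
rewrite inE => /andP[_]; apply: connect_ind => // u v wu /and3P[_ uv _].
exact: le_trans wu (ltW uv).
Qed.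

(* On the way from [w] to a non-neighbour, everything after the last neighbour
   of [w] is a non-neighbour. *)
Lemma reach_peel (B B' : {set V}) (w : V) :
  B' = reach B w :\: [set v | (v == w) || e w v] ->
  B' \subset \bigcup_(v in [set v in reach B w | up B w v]) reach B' v.
Proof.
move=> B'E; set A' := [set v in _ | _].
pose P x := [|| x == w, x \in A' | x \in \bigcup_(v in A') reach B' v].
have PB x : connect (up B) w x -> P x && ((x == w) || (x \in reach B w)).
  apply: (@connect_ind _ _ (fun x => P x && ((x == w) || (x \in reach B w)))).
    by rewrite /P !eqxx.
  move=> u v /andP[Pu wu] uv.
  have vR : v \in reach B w.
    by case/predU1P: wu uv => [->|]; [exact: reach_root | exact: reach_step].
  rewrite vR orbT andbT /P.
  have wlv : (w < v)%O.
    have /and3P[_ ltuv _] := uv; apply: le_lt_trans ltuv.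
    by case/predU1P: wu => [->|/reach_le].
  have vw : v != w by rewrite gt_eqF.
  rewrite (negbTE vw) /=; case: (boolP (e w v)) => [wv|nwv].
    by rewrite inE vR /up wv wlv /=; case/and3P: uv => _ _ ->.
  have vB' : v \in B' by rewrite B'E in_setD vR andbT inE negb_or vw.
  have uv' : up B' u v by have /and3P[euv luv _] := uv; rewrite /up euv luv.
  case/or3P: Pu => [/eqP uw|uA|/bigcupP[z zA zu]].
  - by move: uv nwv; rewrite uw => /and3P[->].
  - by apply/orP; right; apply/bigcupP; exists u => //; exact: reach_root.
  - by apply/orP; right; apply/bigcupP; exists z => //; exact: reach_step uv'.
apply/subsetP => x; rewrite {1}B'E !inE negb_or -!andbA => /and4P[xw nwx xB wx].
have /andP[/or3P[] //] := PB x wx; first by rewrite (negbTE xw).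
by rewrite inE /up (negbTE nwx) andbF.
Qed.

Hypothesis e_sym : symmetric e.

(** An edge between two private parts would prolong the increasing path to its lower end, so its
    upper end would lie in both reach sets. *)
Lemma private_reach_joined (B : {set V}) (J : {set V}) :
  {in J &, forall i j, i != j ->
    joined (compl e) (private (reach B) J i) (private (reach B) J j)}.
Proof.
move=> i j iJ jJ ij; apply/joinedP => x y.
move=> /setDP[xi xN] /setDP[yj yN].
have nxj : x \notin reach B j.
  by apply: contra xN => xj; apply/bigcupP; exists j => //; rewrite jJ eq_sym.
have nyi : y \notin reach B i.
  by apply: contra yN => yi; apply/bigcupP; exists i => //; rewrite iJ.
have inB z w : z \in reach B w -> z \in B by rewrite inE => /andP[].
apply/andP; split; first by apply: contraNneq nyi => <-.
apply/negP => exy; case: (ltgtP x y) => [xy|yx|xy].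
- by case/negP: nyi; apply: reach_step xi _; rewrite /up exy xy (inB _ _ yj).
- by case/negP: nxj; apply: reach_step yj _; rewrite /up e_sym exy yx (inB _ _ xi).
- by case/negP: nyi; rewrite -xy.
Qed.

(** The path is built from its lowest vertex: [A] holds the candidates for it, [B] the room for the
    rest. A comb of reach sets splits [B]. Otherwise some [w] in [A] reaches much of [B] and heads
    the path, and the rest is sought in what [w] reaches outside its neighbourhood, starting at a
    neighbour of [w]. *)
Lemma reach_path_or_split (j D : nat) (A B : {set V}) : 0 < D ->
  (forall x, x \in A :|: B -> #|[set v in B | (v == x) || e x v]| <= D) ->
  B \subset \bigcup_(x in A) reach B x ->
  2 ^ (15 * j.+1) * D <= #|B| ->
  (exists x s, [/\ x \in A, size s = j, {subset s <= B} & ipath (x :: s)]) \/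
  (exists F : seq {set V}, [/\ 1 < size F, pairwise (joined (compl e)) F &
    forall X, X \in F ->
      X \subset B /\ #|B| <= 2 ^ (15 * j.+1) * size F ^ 4 * #|X|]).
Proof.
move=> D0; elim: j A B => [|j IH] A B degD covB bigB.
all: have B0 : 0 < #|B| by apply: leq_trans bigB; rewrite muln_gt0 expn_gt0 D0.
  have /card_gt0P[b bB] := B0; have /bigcupP[x xA _] := subsetP covB _ bB.
  by left; exists x, [::].
have [[w wA bigR]|[J [JA J1 cJ]]] := comb_lemma covB B0; last first.
  right; exists [seq private (reach B) J i | i <- enum J]; split.
  - by rewrite size_map -cardE.
  - rewrite pairwise_map; apply: uniq_pairwise_in => [|x y]; first exact: enum_uniq.
    rewrite !mem_enum => xJ yJ xy /=.
    exact: private_reach_joined.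
  - move=> X /mapP[i]; rewrite mem_enum => iJ ->; split.
      by apply/subsetP => x /setDP[]; rewrite inE => /andP[].
    rewrite size_map -cardE; apply: leq_trans (cJ i iJ) _.
    rewrite leq_mul2r leq_mul2r leq_exp2l //; apply/orP; right; apply/orP; right.
    by rewrite mulnS.
pose N := [set v | (v == w) || e w v].
pose B' := reach B w :\: N; pose A' := [set v in reach B w | up B w v].
have RB : reach B w \subset B by apply/subsetP => x; rewrite inE => /andP[].
have B'B : B' \subset B by apply: subset_trans RB; apply: subsetDl.
have A'B : A' \subset B by apply: subset_trans RB; apply/subsetP => x; rewrite inE => /andP[].
(* A factor [2 ^ 14] is lost to [comb_lemma]; removing the at most [D] reached points of [N] costs
   one further factor [2]. *)
have cB' : #|B| <= 2 ^ 15 * #|B'|.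
  have := cardsID N (reach B w); rewrite -/B'.
  have : #|reach B w :&: N| <= D.
    have wAB : w \in A :|: B by rewrite inE wA.
    apply: leq_trans (degD w wAB).
    apply/subset_leq_card/subsetP => x; rewrite in_setI => /andP[/(subsetP RB) xB xN].
    by move: xN; rewrite !inE xB.
  have : 2 ^ 15 * D <= #|B|.
    by apply: leq_trans bigB; rewrite leq_mul2r leq_exp2l // mulnS leq_addr orbT.
  lia.
case: (IH A' B').
- move=> x xAB; have /degD : x \in A :|: B.
    by move: xAB; rewrite !in_setU => /orP[/(subsetP A'B)|/(subsetP B'B)] ->; rewrite orbT.
  apply: leq_trans; apply/subset_leq_card/subsetP => y.
  by rewrite inE => /andP[/(subsetP B'B) yB xy]; rewrite inE yB.
- exact: reach_peel (erefl B').
- have : 2 ^ 15 * (2 ^ (15 * j.+1) * D) <= 2 ^ 15 * #|B'|.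
    by apply: leq_trans cB'; apply: leq_trans bigB; rewrite mulnA -expnD -mulnS.
  by rewrite leq_pmul2l // expn_gt0.
- move=> [x [s [xA' ss sB' ps]]]; left; exists w, (x :: s); split=> //=.
  + by rewrite ss.
  + move=> y; rewrite inE => /predU1P[->|/sB' /(subsetP B'B) //].
    exact: (subsetP A'B).
  + have /andP[xR /and3P[-> wx _]] : (x \in reach B w) && up B w x by move: xA'; rewrite inE.
    have /= /andP[xs ->] := ps; rewrite wx /= xs !andbT.
    apply/andP; split; apply/allP => y ys.
      exact: lt_trans wx (allP xs y ys).
    by have := sB' y ys; rewrite inE => /andP[]; rewrite inE negb_or => /andP[].
move=> [F [F1 pF cF]]; right; exists F; split=> // X XF.
have [XB' cX] := cF X XF; split; first exact: subset_trans B'B.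
apply: leq_trans cB' _; rewrite (_ : 15 * j.+2 = 15 + 15 * j.+1); last lia.
by rewrite (expnD 2 15) -2!(mulnA (2 ^ 15)) leq_pmul2l ?expn_gt0.
Qed.

Lemma sparse_path_or_split (k D : nat) (U : {set V}) : 0 < k -> 0 < D ->
  (forall x, x \in U -> #|[set v in U | (v == x) || e x v]| <= D) ->
  2 ^ (15 * k) * D <= #|U| ->
  (exists2 s, size s = k & ipath s) \/
  (exists F : seq {set V}, [/\ 1 < size F, pairwise (joined (compl e)) F &
    forall X, X \in F ->
      X \subset U /\ #|U| <= 2 ^ (15 * k) * size F ^ 4 * #|X|]).
Proof.
case: k => // j _ D0 degD bigU.
have [||//|[x [s [_ ss _ ps]]]|] := @reach_path_or_split j D U U D0.
- by move=> x; rewrite setUid; exact: degD.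
- apply/subsetP => x xU; apply/bigcupP; exists x => //.
  by rewrite inE xU connect0.
- by left; exists (x :: s) => //=; rewrite ss.
by right.
Qed.
End SparseGraph.

(** * Edge densities *)

(** Allowing a total preorder makes this serve both to cut intervals out of the vertex order and to
    select elements of smallest value. *)
Lemma exists_lowest (T : finType) (r : rel T) (S : {set T}) (m : nat) :
  total r -> transitive r -> m <= #|S| ->
  exists X : {set T}, [/\ X \subset S, #|X| = m &
    {in X & S :\: X, forall x y, r x y}].
Proof.
move=> r_tot r_tr mS; pose s := sort r (enum S).
have us : uniq s by rewrite sort_uniq enum_uniq.
have ms x : (x \in s) = (x \in S) by rewrite mem_sort mem_enum.
have : pairwise r (take m s ++ drop m s).
  by rewrite cat_take_drop -sorted_pairwise // sort_sorted.
rewrite pairwise_cat => /andP[/allrelP r_td _].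
exists [set x in take m s]; split.
- by apply/subsetP => x; rewrite inE => /mem_take; rewrite ms.
- rewrite cardsE (card_uniqP _) ?take_uniq // size_take size_sort -cardE.
  by case: ltngtP mS.
move=> x y; rewrite !inE => xt /andP[yt yS]; apply: r_td => //.
by move: yS; rewrite -ms -{1}(cat_take_drop m s) mem_cat (negbTE yt).
Qed.

(** The average of the [m] smallest values is at most the overall average: sum [phi x <= phi y] over
    the chosen [x] and the remaining [y]. *)
Lemma lowest_sum (T : finType) (phi : T -> nat) (S : {set T}) (m : nat) :
  m <= #|S| ->
  exists X : {set T}, [/\ X \subset S, #|X| = m &
    #|S| * \sum_(x in X) phi x <= m * \sum_(x in S) phi x].
Proof.
move=> mS; have [||X [XS cX low]] := exists_lowest (r := fun x y => phi x <= phi y) _ _ mS.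
- by move=> x y; exact: leq_total.
- by move=> y x z; exact: leq_trans.
exists X; split=> //.
have cD : #|S| = m + #|S :\: X| by rewrite -(cardsID X S) (setIidPr XS) cX.
have sD : \sum_(x in S) phi x = \sum_(x in X) phi x + \sum_(x in S :\: X) phi x.
  by rewrite (big_setID X) (setIidPr XS).
have : \sum_(x in X) \sum_(y in S :\: X) phi x <= \sum_(x in X) \sum_(y in S :\: X) phi y.
  by apply: leq_sum => x xX; apply: leq_sum => y yS; exact: low.
under eq_bigr do rewrite sum_nat_const.
by rewrite -big_distrr /= sum_nat_const cX cD sD mulnDl mulnDr leq_add2l.
Qed.

Lemma avoid_sets (T : finType) (mu : nat) (X : {set T}) (s : seq {set T}) :
  {in s, forall Z : {set T}, #|Z| <= mu} -> mu * size s < #|X| ->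
  exists2 x, x \in X & {in s, forall Z : {set T}, x \notin Z}.
Proof.
elim: s X => [|Z s IH] X cs bigX.
  by move: bigX; rewrite muln0 => /card_gt0P[x xX]; exists x.
have [||x] := IH (X :\: Z).
- by move=> Y Ys; apply: cs; rewrite inE Ys orbT.
- have := cardsID Z X; have := subset_leq_card (subsetIr X Z).
  have := cs Z (mem_head _ _); move: bigX; rewrite /= mulnS; lia.
rewrite inE => /andP[xZ xX] av; exists x => // Y.
by rewrite inE => /predU1P[->|/av].
Qed.

Lemma joined_sub (T : finType) (e : rel T) (X Y X' Y' : {set T}) :
  X' \subset X -> Y' \subset Y -> joined e X Y -> joined e X' Y'.
Proof.
move=> /subsetP sX /subsetP sY /joinedP h; apply/joinedP => x y /sX xX /sY.
exact: h.
Qed.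

Section Density.
Variables (T : finType) (e : rel T).

Definition nedges (X Y : {set T}) : nat := \sum_(x in X) #|[set y in Y | e x y]|.

(** Edge density at most [1 / h], cleared of denominators. *)
Definition sparse (h : nat) (X Y : {set T}) : bool :=
  [disjoint X & Y] && (h * nedges X Y <= #|X| * #|Y|).

Lemma nedgesE (X Y : {set T}) :
  nedges X Y = \sum_(y in Y) #|[set x in X | e x y]|.
Proof.
rewrite /nedges; under eq_bigr do rewrite cardsE -sum1_card big_mkcondr /=.
rewrite exchange_big /=; apply: eq_bigr => y _.
by rewrite cardsE -sum1_card [RHS]big_mkcondr.
Qed.

Lemma leq_nedges (X Y X' Y' : {set T}) :
  X' \subset X -> Y' \subset Y -> nedges X' Y' <= nedges X Y.
Proof.
move=> sX sY; rewrite /nedges [leqRHS](big_setID X') (setIidPr sX) /=.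
apply: leq_trans (leq_addr _ _); apply: leq_sum => x _.
by apply/subset_leq_card/subsetP => y; rewrite !inE => /andP[/(subsetP sY)->].
Qed.

Lemma nedges_setUl (X X' Y : {set T}) :
  nedges (X :|: X') Y <= nedges X Y + nedges X' Y.
Proof.
rewrite /nedges big_mkcond [X in _ <= X + _]big_mkcond [X in _ <= _ + X]big_mkcond.
rewrite -big_split leq_sum //= => x _; rewrite inE.
by case: (x \in X); case: (x \in X') => //=; rewrite leq_addr.
Qed.

Lemma nedges_setUr (X Y Y' : {set T}) :
  nedges X (Y :|: Y') <= nedges X Y + nedges X Y'.
Proof.
rewrite /nedges -big_split leq_sum //= => x _.
apply: leq_trans (leq_card_setU _ _); apply/subset_leq_card/subsetP => y.
by rewrite !inE -andb_orl.
Qed.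

Lemma nedges_le (X Y : {set T}) : nedges X Y <= #|X| * #|Y|.
Proof.
rewrite /nedges -sum_nat_const leq_sum // => x _.
by apply/subset_leq_card/subsetP => y; rewrite inE => /andP[].
Qed.

Lemma nedges_sym (X Y : {set T}) : symmetric e -> nedges X Y = nedges Y X.
Proof.
by move=> esym; rewrite nedgesE; apply: eq_bigr => y _; apply: eq_card => x; rewrite !inE esym.
Qed.

Lemma sparse_shrink (h m : nat) (X Y : {set T}) : 0 < m ->
  [disjoint X & Y] -> m <= #|X| -> m <= #|Y| ->
  {in X, forall x, h * #|[set y in Y | e x y]| <= #|Y|} ->
  exists A B : {set T}, [/\ A \subset X, B \subset Y, #|A| = m, #|B| = m &
    sparse h A B].
Proof.
move=> m0 disXY mX mY degX.
(* With constant weight [0] this only selects [m] elements, and any will do since all degrees from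
   [X] are small. [B] needs the vertices of least degree into [A]. *)
have [A [AX cA _]] := lowest_sum (fun=> 0) mX.
have [B [BY cB low]] := lowest_sum (fun y => #|[set x in A | e x y]|) mY.
exists A, B; split=> //; apply/andP; split; first exact: disjointW disXY.
move: low; rewrite -!nedgesE cA cB => low.
have : h * nedges A Y <= m * #|Y|.
  rewrite -cA /nedges big_distrr -sum_nat_const /= leq_sum // => x /(subsetP AX).
  exact: degX.
have : 0 < #|Y| by exact: leq_trans mY.
move: low; move: (nedges A B) (nedges A Y) #|Y| => a b c h1 c0 h2.
rewrite -(leq_pmul2l c0); nia.
Qed.

(** The first term bounds each block trivially by [s ^ 2]; the second comes from density [1 / h]
    between blocks. Both orders of a pair are counted. *)
Lemma nedges_bigcup (h s : nat) (F : seq {set T}) : symmetric e ->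
  pairwise (sparse h) F -> {in F, forall X : {set T}, #|X| = s} ->
  let U := \bigcup_(X <- F) X in
  #|U| = size F * s /\
  h * nedges U U <= h * size F * s ^ 2 + (size F * s) ^ 2.
Proof.
move=> esym; elim: F => [|X F IH] /=.
  by rewrite big_nil cards0 /nedges big_set0 => _ _; split; rewrite ?muln0.
move=> /andP[/allP spX pF] cF.
have [|cU dU] := IH pF; first by move=> Y YF; apply: cF; rewrite inE YF orbT.
have cX : #|X| = s by apply: cF; rewrite inE eqxx.
rewrite big_cons; set U := \bigcup_(X <- F) X in cU dU *.
have [disXU dXU] : [disjoint X & U] /\ h * nedges X U <= s * (size F * s).
  rewrite /U {U cU dU IH pF}; elim: F spX cF => [|Y F IH] spX cF.
    rewrite big_nil -setI_eq0 setI0; split=> //.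
    by have := nedges_le X set0; rewrite cards0 muln0; lia.
  rewrite big_cons; have [||d1 n1] := IH.
  - by move=> Z ZF; apply: spX; rewrite inE ZF orbT.
  - by move=> Z; rewrite inE => /predU1P[->|ZF]; apply: cF; rewrite !inE ?eqxx ?ZF ?orbT.
  have /andP[d2 n2] := spX Y (mem_head _ _).
  split; first by rewrite -setI_eq0 setIUr setU_eq0 !setI_eq0 d2.
  have cY : #|Y| = s by apply: cF; rewrite !inE eqxx orbT.
  have := nedges_setUr X Y (\bigcup_(X <- F) X).
  rewrite cX cY in n2; rewrite /= mulSn mulnDr; nia.
split; first by rewrite cardsU disjoint_setI0 // cards0 subn0 cX cU mulSn.
have n1 := nedges_setUl X U (X :|: U).
have n2 := nedges_setUr X X U; have n3 := nedges_setUr U X U.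
have n4 := nedges_le X X; rewrite cX in n4.
rewrite (nedges_sym U X esym) in n3.
move: n1 n2 n3 n4 dXU dU; move: (nedges _ _) (nedges X (X :|: U)).
move: (nedges U (X :|: U)) (nedges X X) (nedges U U) (nedges X U) (size F).
move=> a b c x y z n; rewrite !expnMn -!mulnn; nia.
Qed.
End Density.

(** * Greedy embedding of monotone paths *)

Section Embedding.
Variables (d : Order.disp_t) (V : finOrderType d) (e : rel V).

Local Notation before := (joined (fun x y : V => x < y)%O).

Lemma before_disjoint (X Y : {set V}) : before X Y -> [disjoint X & Y].
Proof.
move=> /joinedP h; rewrite -setI_eq0 -subset0; apply/subsetP => x.
by rewrite !inE => /andP[xX xY]; have := h x x xX xY; rewrite ltxx.
Qed.

Lemma exists_intervals (k m : nat) (S : {set V}) : k * m <= #|S| ->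
  exists Xs : seq {set V}, [/\ size Xs = k, pairwise before Xs &
    {in Xs, forall X : {set V}, X \subset S /\ #|X| = m}].
Proof.
elim: k S => [|k IH] S; first by exists [::].
rewrite mulSn => kS.
have [||X [XS cX low]] :=
  @exists_lowest _ (fun x y : V => x <= y)%O S m _ _ (leq_trans (leq_addr _ _) kS).
- exact: le_total.
- exact: le_trans.
have [|Xs [sXs pXs XsS]] := IH (S :\: X).
  by have := cardsID X S; rewrite (setIidPr XS) cX; lia.
exists (X :: Xs); split=> /=; first by rewrite sXs.
- rewrite pXs andbT; apply/allP => Y /XsS[YS _]; apply/joinedP => x y xX /(subsetP YS) yY.
  rewrite lt_neqAle low // andbT; apply: contraTneq yY => <-.
  by rewrite inE xX.
move=> Y; rewrite inE => /predU1P[-> //|/XsS[YS cY]]; split=> //.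
exact: subset_trans YS (subsetDl _ _).
Qed.

Definition rich (h : nat) (g : rel V) (Y : {set V}) (x : V) : bool :=
  #|Y| < h * #|[set y in Y | g x y]|.

(** Greedy choice from left to right: [x] is taken with many neighbours in the next set and many
    non-neighbours in every later one, and these sets are shrunk accordingly. Each shrinking costs a
    factor [h], hence [h ^ n]; the factor [q] makes [X] larger than all sets of bad vertices
    together. *)
Lemma embed_path (h mu q n : nat) (S : {set V}) : 0 < mu -> 0 < h ->
  (forall X Y : {set V}, X \subset S -> Y \subset S -> before X Y ->
     mu <= #|X| -> mu <= #|Y| ->
     [exists x in X, rich h e Y x] && [exists x in X, rich h (compl e) Y x]) ->
  forall (X : {set V}) (Xs : seq {set V}), size Xs = n -> n < q ->
    pairwise before (X :: Xs) ->
    {in X :: Xs, forall Y : {set V}, Y \subset S /\ mu * q * h ^ n <= #|Y|} ->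
  exists x s, [/\ x \in X, size s = n, ipath e (x :: s) &
    {in s, forall y, exists2 Y : {set V}, Y \in Xs & y \in Y}].
Proof.
move=> mu0 h0 mixed; elim: n => [|n IH] X Xs sXs nq pXs bigXs.
  have [_ bigX] := bigXs X (mem_head _ _).
  have /card_gt0P[x xX] : 0 < #|X|.
    by apply: leq_trans bigX; rewrite !muln_gt0 mu0 nq.
  by exists x, [::]; split.
case: Xs sXs pXs bigXs => // Y Zs [sZs] pXs bigXs.
have big W : W \in [:: X, Y & Zs] -> mu * q <= #|W|.
  by move=> /bigXs[_]; apply: leq_trans; rewrite leq_pmulr // expn_gt0 h0.
have big' W : W \in [:: X, Y & Zs] -> mu <= #|W|.
  by move=> /big; apply: leq_trans; rewrite leq_pmulr //; lia.
have /= /andP[/andP[XY /allP XZ] /andP[/allP YZ pZ]] := pXs.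
have [XS _] := bigXs X (mem_head _ _).
pose poor (g : rel V) (W : {set V}) := [set x in X | ~~ rich h g W x].
(* By [mixed], any [mu] vertices of [X] include one that is rich towards [W]. *)
have poor_small g W : W \in Y :: Zs -> g = e \/ g = compl e -> #|poor g W| <= mu.
  move=> WYZ ge; rewrite leqNgt; apply/negP => /ltnW big_poor.
  have WX : W \in [:: X, Y & Zs] by rewrite inE WYZ orbT.
  have [WS _] := bigXs W WX.
  have XW : before X W by move: WYZ; rewrite inE => /predU1P[-> //|/XZ].
  have poorX : poor g W \subset X by apply/subsetP => x; rewrite inE => /andP[].
  have := mixed (poor g W) W (subset_trans poorX XS) WS
    (joined_sub poorX (subxx _) XW) big_poor (big' W WX).
  case: ge => -> /andP[/exists_inP[x xp r1] /exists_inP[y yp r2]].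
    by move: xp; rewrite inE r1 andbF.
  by move: yp; rewrite inE r2 andbF.
have [||x xX av] := @avoid_sets _ mu X (poor e Y :: [seq poor (compl e) Z | Z <- Zs]).
- move=> W; rewrite inE => /predU1P[->|/mapP[Z ZZs ->]]; apply: poor_small;
    rewrite ?mem_head ?inE ?ZZs ?orbT //; by [left|right].
- have := big X (mem_head _ _); rewrite /= size_map sZs; apply: leq_trans.
  by rewrite ltn_pmul2l.
have richY : rich h e Y x.
  by have := av _ (mem_head _ _); rewrite inE xX negbK.
have richZ Z : Z \in Zs -> rich h (compl e) Z x.
  move=> ZZs; have := av (poor (compl e) Z); rewrite !inE xX /= negbK; apply.
  by rewrite map_f ?orbT.
pose nb (g : rel V) (W : {set V}) := [set y in W | g x y].
have nbW g W : nb g W \subset W by apply/subsetP => y; rewrite inE => /andP[].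
have big_nb g W : W \in [:: X, Y & Zs] -> rich h g W x ->
    nb g W \subset S /\ mu * q * h ^ n <= #|nb g W|.
  move=> /bigXs[WS cW]; rewrite /rich -/(nb g W) => rW.
  split; first exact: subset_trans (nbW g W) WS.
  by rewrite -(leq_pmul2l h0) mulnCA -expnS (leq_trans cW) // ltnW.
have [||||y [s [yY ss ps sZ]]] := IH (nb e Y) [seq nb (compl e) Z | Z <- Zs].
- by rewrite size_map.
- exact: ltnW.
- rewrite /= pairwise_map all_map; apply/andP; split.
    by apply/allP => Z /YZ /=; apply: joined_sub.
  by apply: sub_pairwise pZ => Z W; apply: joined_sub.
- move=> W; rewrite inE => /predU1P[->|/mapP[Z ZZs ->]].
    by apply: big_nb => //; rewrite !inE eqxx orbT.
  by apply: big_nb; rewrite ?inE ?ZZs ?orbT ?richZ.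
have sZ' z : z \in s -> exists2 Z, Z \in Zs & (z \in Z) && ~~ e x z.
  move=> /sZ[_ /mapP[Z ZZs ->]]; rewrite inE => /andP[zZ /andP[_ xz]].
  by exists Z => //; rewrite zZ.
move: yY; rewrite inE => /andP[yY xy].
exists x, (y :: s); split=> //=; first by rewrite ss.
- have /= -> := ps; rewrite andbT xy /= -andbA; apply/and3P; split.
  + by move/joinedP: XY; apply.
  + by apply/allP => z /sZ'[Z /XZ/joinedP XZ' /andP[zZ _]]; apply: XZ'.
  + by apply/allP => z /sZ'[Z _ /andP[]].
move=> z; rewrite inE => /predU1P[->|/sZ'[Z ZZs /andP[zZ _]]].
  by exists Y; rewrite ?mem_head.
by exists Z; rewrite // inE ZZs orbT.
Qed.

(** Cut [S] into [k] consecutive intervals of size [#|S| %/ k]. Since [embed_path] must fail on them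
    with [mu = m], some set of at least [m] vertices is entirely poor towards a later one, and
    [sparse_shrink] trims this pair. In the divisor, one [k] pays for the intervals and [k * h ^ k]
    for the embedding. *)
Lemma sparse_or_dense_pair (k h : nat) (S : {set V}) : 0 < k -> 0 < h ->
  (forall s, size s = k -> ~~ ipath e s) ->
  let m := #|S| %/ (k * (k * h ^ k)) in
  exists A B : {set V}, [/\ A \subset S, B \subset S, #|A| = m, #|B| = m &
    sparse e h A B || sparse (compl e) h A B].
Proof.
move=> k0 h0 noP m.
have [m0|m0] := posnP m.
  exists set0, set0; split; rewrite ?sub0set ?cards0 //.
  by rewrite /sparse -setI_eq0 setI0 eqxx /nedges big_set0 muln0.
case: (boolP [exists X : {set V}, exists Y : {set V},
    [&& X \subset S, Y \subset S, before X Y, m <= #|X|, m <= #|Y| &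
    [forall x in X, ~~ rich h e Y x] || [forall x in X, ~~ rich h (compl e) Y x]]]).
  move=> /existsP[X /existsP[Y /and5P[XS YS XY mX /andP[mY poor]]]].
  have disXY := before_disjoint XY.
  case/orP: poor => /forall_inP poor.
    have [|A [B [AX BY cA cB sp]]] := @sparse_shrink _ e h m X Y m0 disXY mX mY.
      by move=> x /poor; rewrite -leqNgt.
    by exists A, B; rewrite sp; split=> //; [apply: subset_trans XS | apply: subset_trans YS].
  have [|A [B [AX BY cA cB sp]]] := @sparse_shrink _ (compl e) h m X Y m0 disXY mX mY.
    by move=> x /poor; rewrite -leqNgt.
  by exists A, B; rewrite sp orbT; split=> //; [apply: subset_trans XS | apply: subset_trans YS].
rewrite negb_exists => /forallP mixed; exfalso.
have := @exists_intervals k (#|S| %/ k) S; rewrite mulnC leq_divM => /(_ isT).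
case: k k0 noP @m m0 mixed => // k _ noP m m0 mixed [[|X Xs] [// [sXs] pXs XsS]].
have [||x [s [_ ss ps _]]] :=
  @embed_path h m k.+1 k S m0 h0 _ X Xs sXs (leqnn _) pXs.
- move=> Y Z YS ZS YZ mY mZ; have := mixed Y; rewrite negb_exists => /forallP/(_ Z).
  rewrite YS ZS YZ mY mZ /= negb_or !negb_forall_in.
  move=> /andP[/exists_inP[y yY /negPn ry] /exists_inP[z zY /negPn rz]].
  by apply/andP; split; apply/exists_inP; [exists y|exists z].
- move=> Y /XsS[YS ->]; split=> //.
  apply: (@leq_trans (m * (k.+1 * h ^ k.+1))).
    by rewrite mulnA leq_mul2l leq_pexp2l ?orbT.
  by rewrite /m divnMA leq_divM.
by have := noP (x :: s); rewrite ps /= ss => /(_ erefl).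
Qed.

End Embedding.

(** * From sparse or dense pairs to cliques and independent sets *)

Definition sparse_family (T : finType) (g : rel T) (h s : nat) (S : {set T})
    (F : seq {set T}) : Prop :=
  pairwise (sparse g h) F /\ {in F, forall X : {set T}, X \subset S /\ #|X| = s}.

Lemma sparse_family_sub (T : finType) (g : rel T) (h s : nat) (A S : {set T}) F :
  A \subset S -> sparse_family g h s A F -> sparse_family g h s S F.
Proof.
by move=> AS [pF FA]; split=> // X /FA[XA ->]; rewrite (subset_trans XA).
Qed.

(** Passing from size [m] to a nonzero [s = m %/ q] on both sides multiplies the density by at most
    [(m / s) ^ 2 <= 4 * q ^ 2], which the sparsity of [A] and [B] allows for. *)
Lemma sparse_family_cat (T : finType) (g : rel T) (h q m : nat)
    (S A B : {set T}) (F G : seq {set T}) :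
  0 < q -> A \subset S -> B \subset S -> #|A| = m -> #|B| = m ->
  sparse g (4 * q ^ 2 * h) A B ->
  sparse_family g h (m %/ q) A F -> sparse_family g h (m %/ q) B G ->
  sparse_family g h (m %/ q) S (F ++ G).
Proof.
move=> q0 AS BS cA cB /andP[disAB spAB] FA GB.
have [pF _] := FA; have [pG _] := GB.
have [[_ FS] [_ GS]] := (sparse_family_sub AS FA, sparse_family_sub BS GB).
split; last by move=> X; rewrite mem_cat => /orP[/FS|/GS].
rewrite pairwise_cat pF pG !andbT; apply/allrelP => X Y XF YG.
have [XA cX] := FA.2 X XF; have [YB cY] := GB.2 Y YG.
rewrite /sparse (disjointW XA YB disAB) /=.
have := leq_nedges g XA YB; have := nedges_le g X Y.
have := ltn_ceil m q0; move: spAB; rewrite cA cB cX cY.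
move: (m %/ q) (nedges g X Y) (nedges g A B) => s a b.
case: s => [|s]; first by rewrite !mul0n leqn0 => _ _ /eqP->; rewrite muln0.
move=> h1 h2 _ ab; have h3 : m <= 2 * s.+1 * q by nia.
have h4 : m * m <= 4 * q ^ 2 * (s.+1 * s.+1).
  by have := leq_mul h3 h3; rewrite -mulnn; lia.
rewrite -(@leq_pmul2l (4 * q ^ 2)) ?muln_gt0 ?expn_gt0 ?q0 //.
by rewrite (leq_trans _ h4) // (leq_trans _ h1) // mulnA leq_mul2l ab orbT.
Qed.

(* The sizes of a sparse and of a dense family are tracked through their product,
   as for the clique and independence numbers of a cograph. *)
Lemma exists_families (k r : nat) : 0 < k -> forall h, 0 < h ->
  exists2 q, 0 < q & forall (d : Order.disp_t) (V : finOrderType d) (e : rel V),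
    (forall s, size s = k -> ~~ ipath e s) -> forall S : {set V},
    exists F G : seq {set V}, [/\ 2 ^ r <= size F * size G,
      sparse_family e h (#|S| %/ q) S F &
      sparse_family (compl e) h (#|S| %/ q) S G].
Proof.
move=> k0; elim: r => [|r IH] h h0.
  exists 1 => // d V e _ S; exists [:: S], [:: S].
  by split=> //; split=> // X; rewrite inE divn1 => /eqP->.
have [q q0 famq] := IH h h0.
have h'0 : 0 < 4 * q ^ 2 * h by rewrite -mulnn; lia.
exists (k * (k * (4 * q ^ 2 * h) ^ k) * q).
  by rewrite !muln_gt0 k0 expn_gt0 h'0 q0.
move=> d V e noP S; rewrite divnMA.
have := sparse_or_dense_pair S k0 h'0 noP.
move: (_ %/ (k * _)) => m [A [B [AS BS cA cB sp]]].
have [FA [GA [szA FAf GAf]]] := famq d V e noP A.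
have [FB [GB [szB FBf GBf]]] := famq d V e noP B.
rewrite cA in FAf GAf; rewrite cB in FBf GBf.
case/orP: sp => sp.
  have FAB := sparse_family_cat q0 AS BS cA cB sp FAf FBf.
  (* Concatenating one kind and keeping the longer family of the other kind doubles the product:
     [(a + a') * max(b, b') >= a * b + a' * b']. *)
  have [le|/ltnW le] := leqP (size GA) (size GB).
    exists (FA ++ FB), GB; split=> //; last exact: sparse_family_sub BS GBf.
    by rewrite size_cat expnS; nia.
  exists (FA ++ FB), GA; split=> //; last exact: sparse_family_sub AS GAf.
  by rewrite size_cat expnS; nia.
have GAB := sparse_family_cat q0 AS BS cA cB sp GAf GBf.
have [le|/ltnW le] := leqP (size FA) (size FB).
  exists FB, (GA ++ GB); split=> //; last exact: sparse_family_sub BS FBf.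
  by rewrite size_cat expnS; nia.
exists FA, (GA ++ GB); split=> //; last exact: sparse_family_sub AS FAf.
by rewrite size_cat expnS; nia.
Qed.

(** The average degree in [U] is at most [2 * s], so at most half of the vertices have degree above
    [4 * s]. Counting the vertex itself adds one, which is at most [s]. *)
Lemma low_degree_half (T : finType) (g : rel T) (p s : nat) (U : {set T}) :
  0 < s -> #|U| = p * s -> nedges g U U <= 2 * p * s ^ 2 ->
  exists W : {set T}, [/\ W \subset U, #|U| <= 2 * #|W| &
    {in W, forall u, #|[set v in W | (v == u) || g u v]| <= 5 * s}].
Proof.
move=> s0 cU dU; pose W := [set u in U | #|[set v in U | g u v]| <= 4 * s].
have WU : W \subset U by apply/subsetP => u; rewrite inE => /andP[].
exists W; split=> //.
  have : #|U :\: W| * (4 * s) <= nedges g U U.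
    rewrite -sum_nat_const /nedges [leqRHS](big_setID W) /= -[leqLHS]add0n leq_add //.
    by apply: leq_sum => u; rewrite !inE => /andP[+ uU]; rewrite uU -ltnNge => /ltnW.
  have := cardsID W U; rewrite (setIidPr WU).
  move: dU; rewrite cU -mulnn.
  move: (nedges g U U) #|W| #|U :\: W| => a b c h1 h2 h3.
  have : c * (4 * s) <= 2 * p * s * s by rewrite -mulnA; lia.
  nia.
move=> u; rewrite inE => /andP[uU deg].
apply: (@leq_trans #|u |: [set v in U | g u v]|).
  apply/subset_leq_card/subsetP => v; rewrite !inE => /andP[/andP[vU _]].
  by rewrite vU.
by have := cardsU1 u [set v in U | g u v]; case: (u \notin _); lia.
Qed.

Lemma compl_symmetric (T : eqType) (e : rel T) : symmetric e -> symmetric (compl e).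
Proof. by move=> se x y; rewrite /compl eq_sym se. Qed.

(* The analogue of Rödl's theorem for graphs without an induced monotone path. *)
Lemma sparse_or_dense_subset (k M : nat) : 0 < k -> 0 < M ->
  exists2 q, 0 < q & forall (d : Order.disp_t) (V : finOrderType d) (e : rel V),
    symmetric e -> (forall s, size s = k -> ~~ ipath e s) ->
    forall S : {set V}, q <= #|S| ->
    exists g (D : nat) (W : {set V}), [/\ g = e \/ g = compl e, 0 < D, W \subset S,
      {in W, forall u, #|[set v in W | (v == u) || g u v]| <= D} &
      M * D <= #|W| /\ #|S| <= q * #|W|].
Proof.
(* This [p] gives [#|W| >= p * s / 2 = M * (5 * s)], matching the degree bound [5 * s]. As
   [2 ^ (p * p)] exceeds [p * p], one of the two families has at least [p] members. *)
move=> k0 M0; pose p := 10 * M; have p0 : 0 < p by rewrite muln_gt0.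
have [q q0 fam] := exists_families (p * p) k0 p0.
exists (2 * q); first by rewrite muln_gt0.
move=> d V e esym noP S bigS.
have [F [G [szFG Ff Gf]]] := fam d V e noP S.
have [g [H [gE pH Hf]]] : exists g H,
    [/\ g = e \/ g = compl e, p <= size H & sparse_family g p (#|S| %/ q) S H].
  have : p * p < size F * size G by apply: leq_trans szFG; apply: ltn_expl.
  have [pF|Fp] := leqP p (size F); first by exists e, F; split; auto.
  have [pG|Gp] := leqP p (size G); first by exists (compl e), G; split; auto.
  by move=> ?; have := leq_mul (ltnW Fp) (ltnW Gp); lia.
have gsym : symmetric g by case: gE => -> //; exact: compl_symmetric.
set s := #|S| %/ q in Hf.
have s0 : 0 < s by rewrite divn_gt0 //; lia.
have Sq : #|S| <= 2 * q * s by have := ltn_ceil #|S| q0; rewrite -/s; nia.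
have [pairH HS] := Hf.
(* With exactly [p] blocks and density [1 / p], the edges inside and between blocks are each bounded
   by [p * s ^ 2]. *)
have [||cU dU] := @nedges_bigcup _ g p s (take p H) gsym.
- by move: pairH; rewrite -{1}(cat_take_drop p H) pairwise_cat => /and3P[].
- by move=> X /mem_take/HS[].
set U := \bigcup_(X <- take p H) X in cU dU.
rewrite size_takel // in cU dU.
have US : U \subset S.
  by rewrite /U bigcup_seq; apply/bigcupsP => X /mem_take/HS[].
have [|W [WU cW degW]] := @low_degree_half _ g p s U s0 cU.
- by rewrite -(leq_pmul2l p0) (leq_trans dU) // expnMn; nia.
exists g, (5 * s), W; split=> //.
- by rewrite muln_gt0.
- exact: subset_trans WU US.
rewrite cU /p in cW; split; first by nia.
by rewrite (leq_trans Sq) // leq_mul2l; apply/orP; right; nia.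
Qed.

Lemma compl_compl (T : eqType) (e : rel T) : irreflexive e -> compl (compl e) =2 e.
Proof.
move=> irr x y; rewrite /compl negb_and !negbK.
by case: eqVneq => [->|] /=; rewrite ?irr.
Qed.

Lemma joined_eq (T : finType) (e f : rel T) : e =2 f -> joined e =2 joined f.
Proof.
move=> ef X Y; apply/joinedP/joinedP => h x y xX yY; first by rewrite -ef h.
by rewrite ef h.
Qed.

Lemma quasi_erdos_hajnal (k : nat) : 0 < k ->
  exists2 C, 0 < C & forall (d : Order.disp_t) (V : finOrderType d) (e : rel V),
    symmetric e -> irreflexive e -> (forall s, size s = k -> ~~ ipath e s) ->
    (forall s, size s = k -> ~~ ipath (compl e) s) ->
    forall S : {set V}, 1 < #|S| ->
    exists F : seq {set V}, [/\ 1 < size F,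
      pairwise (joined e) F \/ pairwise (joined (compl e)) F &
      {in F, forall X : {set V}, X \subset S /\ #|S| <= size F ^ C * #|X|}].
Proof.
move=> k0; pose M := 2 ^ (15 * k); have M0 : 0 < M by rewrite expn_gt0.
have [q q0 rodl] := sparse_or_dense_subset k0 M0.
(* Since [size F >= 2], the constant [q * M] is absorbed into [size F ^ (q * M)]; the [4] is the
   exponent coming from combs. *)
exists (q * M + 4); first by rewrite addn4.
move=> d V e esym eirr noP noPc S S1.
have [smallS|bigS] := ltnP #|S| q.
  (* Two singletons suffice here, because [#|S| < q <= 2 ^ C]. *)
  have /card_gt1P[x [y [xS yS xy]]] := S1.
  exists [:: [set x]; [set y]]; split=> //=.
    have [exy|nexy] := boolP (e x y); [left|right];
      rewrite !andbT; apply/joinedP => u v /set1P-> /set1P-> //.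
    by rewrite /compl xy.
  move=> X; rewrite !inE => XE; have [XS ->] : X \subset S /\ #|X| = 1.
    by case/orP: XE => /eqP->; rewrite sub1set cards1.
  split=> //; rewrite muln1 (leq_trans (ltnW smallS)) // ltnW //.
  apply: leq_trans (ltn_expl q (isT : 1 < 2)) _.
  by rewrite leq_exp2l // (leq_trans (leq_pmulr q M0)) ?leq_addr.
have [g [D [W [gE D0 WS degW [bigW SW]]]]] := rodl d V e esym noP S bigS.
have gsym : symmetric g by case: gE => -> //; exact: compl_symmetric.
have [[s ss ps]|[F [F1 pF bigF]]] := sparse_path_or_split gsym k0 D0 degW bigW.
  by case: gE ps => ->; rewrite ?(negbTE (noP s ss)) ?(negbTE (noPc s ss)).
exists F; split=> //.
  case: gE pF => -> pF; [by right|left].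
  by apply: sub_pairwise pF => X Y; rewrite (joined_eq (compl_compl eirr)).
move=> X XF; have [XW cX] := bigF X XF; split; first exact: subset_trans WS.
apply: leq_trans SW _; apply: (@leq_trans (q * M * size F ^ 4 * #|X|)).
  by rewrite -2!(mulnA q) leq_mul2l cX orbT.
rewrite leq_mul2r (expnD _ (q * M)) leq_mul2r; apply/orP; right; apply/orP; right.
exact: ltnW (ltn_expl _ F1).
Qed.

(** This lets the induction descend to the parts: two nonempty sets joined by an irreflexive
    relation are disjoint, so each part misses a point of [S]. *)
Lemma pairwise_joined_ltn (T : finType) (g : rel T) (F : seq {set T}) (S X : {set T}) :
  (forall x, ~~ g x x) -> 1 < size F -> pairwise (joined g) F ->
  (forall Y, Y \in F -> Y \subset S /\ 0 < #|Y|) -> X \in F -> #|X| < #|S|.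
Proof.
move=> girr F1 pF FS XF.
have [Y YF XY] : exists2 Y, Y \in F & joined g X Y || joined g Y X.
  case/splitPr: XF F1 pF {FS} => F1 F2; rewrite size_cat pairwise_cat /=.
  case: F2 => [|Y F2] /=.
    case: F1 => // Y F1 _ /and3P[/allrelP FX _ _].
    by exists Y; rewrite ?mem_cat ?(FX Y X) ?mem_head ?orbT.
  move=> _ /and3P[_ _ /andP[/andP[XY _] _]].
  by exists Y; rewrite ?XY // mem_cat !inE eqxx !orbT.
have [YS /card_gt0P[y yY]] := FS Y YF; have [XS _] := FS X XF.
apply: proper_card; apply/properP; split=> //; exists y; first exact: (subsetP YS).
apply: contraNN (girr y) => yX.
by case/orP: XY => /joinedP; apply.
Qed.

(** * Induction on the product of clique and independent set sizes *)

Definition complete_set (T : finType) (e : rel T) (A : {set T}) : Prop :=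
  {in A &, forall x y, x != y -> e x y}.

(** The sets [A] of the parts are united and the largest [B] is kept, so the product of sizes is at
    least the sum of the products over the parts. *)
Lemma join_families (T : finType) (e f : rel T) (m : nat) (F : seq {set T}) :
  symmetric e -> pairwise (joined e) F ->
  {in F, forall X : {set T}, exists A B : {set T}, [/\ A \subset X, B \subset X,
     complete_set e A, complete_set f B & m <= #|A| * #|B|]} ->
  (forall x, ~~ e x x) ->
  exists A B : {set T}, [/\ A \subset \bigcup_(X <- F) X,
    B \subset \bigcup_(X <- F) X,
    complete_set e A, complete_set f B & size F * m <= #|A| * #|B|].
Proof.
move=> esym + + eirr; elim: F => [|X F IH] /=.
  exists set0, set0; split; rewrite ?sub0set ?mul0n // => x y; by rewrite inE.
move=> /andP[/allP XF pF] ABF.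
have [|A [B [AF BF cA cB mAB]]] := IH pF.
  by move=> Y YF; apply: ABF; rewrite inE YF orbT.
have [A' [B' [AX BX cA' cB' mAB']]] := ABF X (mem_head _ _).
have AA' x y : x \in A' -> y \in A -> e x y.
  move=> /(subsetP AX) xX /(subsetP AF); rewrite bigcup_seq => /bigcupP[Y YF yY].
  by have /joinedP := XF Y YF; apply.
have disA : [disjoint A' & A].
  rewrite -setI_eq0 -subset0; apply/subsetP => x; rewrite inE => /andP[xA' xA].
  by have := AA' x x xA' xA; rewrite (negbTE (eirr x)).
have cAA : complete_set e (A' :|: A).
  move=> x y; rewrite !inE => /orP[xA|xA] /orP[yA|yA] xy; first exact: cA'.
  - exact: AA'.
  - by rewrite esym; exact: AA'.
  exact: cA.
rewrite big_cons.
have cAA' : #|A' :|: A| = #|A'| + #|A| by rewrite cardsU disjoint_setI0 // cards0 subn0.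
have AU : A' :|: A \subset X :|: \bigcup_(Y <- F) Y by apply: setUSS.
have [le|/ltnW le] := leqP #|B| #|B'|.
  exists (A' :|: A), B'; split=> //; last by rewrite cAA' mulSn; nia.
  exact: subset_trans BX (subsetUl _ _).
exists (A' :|: A), B; split=> //; last by rewrite cAA' mulSn; nia.
exact: subset_trans BF (subsetUr _ _).
Qed.

Lemma erdos_hajnal_paths (k : nat) : 0 < k ->
  exists2 C, 0 < C & forall (d : Order.disp_t) (V : finOrderType d) (e : rel V),
    symmetric e -> irreflexive e -> (forall s, size s = k -> ~~ ipath e s) ->
    (forall s, size s = k -> ~~ ipath (compl e) s) ->
    forall S : {set V}, exists A B : {set V}, [/\ A \subset S, B \subset S,
      complete_set e A, complete_set (compl e) B & #|S| <= (#|A| * #|B|) ^ C].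
Proof.
move=> k0; have [C C0 split_C] := quasi_erdos_hajnal k0; exists C => //.
move=> d V e esym eirr noP noPc S.
have [n] := ubnP #|S|; elim: n S => // n IH S; rewrite ltnS => Sn.
have [S1|S1] := leqP #|S| 1.
  have cS g : complete_set g S.
    by move=> x y xS yS; rewrite (card_le1_eqP S1 x y xS yS) eqxx.
  exists S, S; split=> //; case: #|S| S1 => [|[|]] // _; by rewrite exp1n.
have [F [F1 pF bigF]] := split_C d V e esym eirr noP noPc S S1.
(* The least such [m] is an integer stand-in for the [C]-th root of [#|S|] divided by [size F]. By
   minimality every part has product at least [m], so the joined sets reach [size F * m]. *)
have ex : exists m, #|S| <= (size F * m) ^ C.
  exists #|S|; apply: (@leq_trans (size F * #|S|)); first by rewrite leq_pmull // ltnW.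
  by rewrite -{1}[_ * _]expn1 leq_pexp2l // muln_gt0; lia.
case: (ex_minnP ex) => m mS minm.
have small X : X \in F -> #|X| < #|S|.
  have nonempty Y : Y \in F -> Y \subset S /\ 0 < #|Y|.
    move=> /bigF[YS cY]; split=> //; move: (leq_trans (ltnW S1) cY).
    by rewrite muln_gt0 => /andP[].
  move=> XF; case: pF => pF; apply: pairwise_joined_ltn pF nonempty XF => // x.
    by rewrite eirr.
  by rewrite /compl eqxx.
have ABF : {in F, forall X : {set V}, exists A B : {set V}, [/\ A \subset X,
    B \subset X, complete_set e A, complete_set (compl e) B & m <= #|A| * #|B|]}.
  move=> X XF; have [A [B [AX BX cA cB XAB]]] := IH X (leq_trans (small X XF) Sn).
  exists A, B; split=> //; apply: minm; have [_ SX] := bigF X XF.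
  by apply: leq_trans SX _; rewrite expnMn leq_mul2l XAB orbT.
have US : \bigcup_(X <- F) X \subset S by rewrite bigcup_seq; apply/bigcupsP => X /bigF[].
case: pF => pF.
  have [|A [B [AU BU cA cB FAB]]] := join_families esym pF ABF.
    by move=> x; rewrite eirr.
  exists A, B; split=> //; rewrite ?(subset_trans AU) ?(subset_trans BU) //.
  by rewrite (leq_trans mS) // leq_exp2r.
have BAF : {in F, forall X : {set V}, exists A B : {set V}, [/\ A \subset X,
    B \subset X, complete_set (compl e) A, complete_set e B & m <= #|A| * #|B|]}.
  by move=> X /ABF[A [B [? ? ? ?]]]; rewrite mulnC; exists B, A.
have [|A [B [AU BU cA cB FAB]]] := join_families (compl_symmetric esym) pF BAF.
  by move=> x; rewrite /compl eqxx.
exists B, A; split=> //; rewrite ?(subset_trans AU) ?(subset_trans BU) //.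
by rewrite (leq_trans mS) // leq_exp2r // [#|B| * _]mulnC.
Qed.

(** * Induced copies of the monotone path and the real exponent *)

Lemma ipath_nth (d : Order.disp_t) (V : finOrderType d) (e : rel V) (x0 : V) (s : seq V)
    (i j : nat) :
  ipath e s -> i < j < size s ->
  (nth x0 s i < nth x0 s j)%O /\ e (nth x0 s i) (nth x0 s j) = (j == i.+1).
Proof.
elim: s i j => [|x s IH] i j; first by rewrite andbF.
case: i j => [|i] [|j] //= /and3P[/allP xs es ps]; rewrite ltnS; last exact: IH.
move=> js; split; first by apply: xs; rewrite mem_nth.
case: s es js {IH xs ps} => // y s /andP[exy /allP nes].
by case: j => [//|j] js /=; apply/negbTE/nes; rewrite mem_nth.
Qed.

Lemma ipath_induced (k : nat) (G : ordered_graph) (s : seq G) :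
  size s = k -> ipath (edge G) s -> induced_ordered_subgraph (monotone_path k) G.
Proof.
move=> sk ps; case: s => [|x0 s] in sk ps *.
  (* For the empty path there is no vertex to serve as the default of [nth]. *)
  rewrite -sk; exists (fun i : 'I_0 => match i with Ordinal _ h => False_rect _ (notF h) end).
  by split; case.
set t := x0 :: s in sk ps; pose f (i : 'I_k) := nth x0 t i.
have fP (i j : 'I_k) : i < j -> (f i < f j)%O /\ edge G (f i) (f j) = (j == i.+1 :> nat).
  by move=> ij; apply: ipath_nth ps _; rewrite ij sk ltn_ord.
have fE (i j : 'I_k) : edge G (f i) (f j) = path_edge i j.
  rewrite /path_edge; case: (ltngtP i j) => [ij|ji|/val_inj ij].
  - by rewrite (fP i j ij).2 (_ : (i == j.+1 :> nat) = false) ?orbF //; lia.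
  - by rewrite edge_sym (fP j i ji).2 (_ : (j == i.+1 :> nat) = false) //; lia.
  - by rewrite ij edge_irr (ltn_eqF (ltnSn j)).
exists f; split=> // [i j fij|i j].
  case: (ltngtP i j) => [/fP[]|/fP[]|/val_inj //]; by rewrite fij ltxx.
rewrite le_eqVlt => /predU1P[-> //|]; rewrite ltEord => /fP[lt_f _]; exact: ltW.
Qed.

Local Open Scope ring_scope.

Theorem theorem1 (R : realType) (k : nat) (hk : (0 < k)%N) :
  exists2 c : R, 0 < c &
    forall (n : nat) (G : ordered_graph), #|G| = n ->
      ~ induced_ordered_subgraph (monotone_path k) G ->
      ~ induced_ordered_subgraph (monotone_path k) (compl_graph G) ->
      exists A : {set G},
        (clique A \/ independent A) /\ n%:R `^ c <= #|A|%:R.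
Proof.
have [C C0 EH] := erdos_hajnal_paths hk.
(* From [n <= (#|A| * #|B|) ^ C], the larger of the two sets has at least [n ^ (1 / (2 * C))]
   elements. *)
pose c : R := (2 * C)%:R^-1.
have c0 : 0 < c by rewrite invr_gt0 ltr0n muln_gt0.
exists c => // n G cG noP noPc.
have [||||A [B [_ _ cA cB]]] := EH _ G (edge G) _ _ _ _ [set: G].
- exact: edge_sym.
- exact: edge_irr.
- by move=> s sk; apply/negP => /(ipath_induced sk).
- by move=> s sk; apply/negP => ps; apply: noPc; exact: (@ipath_induced k (compl_graph G) s).
rewrite cardsT cG => nAB.
have bound m : (#|A| * #|B| <= m ^ 2)%N -> n%:R `^ c <= m%:R :> R.
  move=> ABm; have nm : (n <= m ^ (2 * C))%N.
    by rewrite (leq_trans nAB) // expnM leq_exp2r.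
  apply: (@le_trans _ _ ((m ^ (2 * C))%:R `^ c)).
    by rewrite ge0_ler_powR ?nnegrE ?ler0n ?ler_nat // ltW.
  rewrite natrX -powR_mulrn ?ler0n // -powRrM mulfV ?powRr1 ?ler0n //.
  by rewrite pnatr_eq0 -lt0n muln_gt0.
have [AB|/ltnW BA] := leqP #|A| #|B|.
  exists B; split; last by apply: bound; rewrite -mulnn leq_mul2r AB orbT.
  right=> x y xB yB; have [->|xy] := eqVneq x y; first by rewrite edge_irr.
  by have /andP[] := cB x y xB yB xy.
exists A; split; first by left.
by apply: bound; rewrite -mulnn leq_mul2l BA orbT.
Qed.
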